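(* Every finite affinely independent set $A\subset\mathbb{R}^n$ is Euclidean sub-$p$-toral for all sufficiently large primes $p\ge p_0(A)$.
   Context: A $p$-torus is a group isomorphic to $(\mathbb{Z}_p)^\alpha$ for some $\alpha\ge1$. A set $X\subset\mathbb{R}^k$ is Euclidean sub-$p$-toral if there exist $n\ge k$, a $p$-torus $G$ and an action of $G$ on $\mathbb{R}^n$ by isometries such that $X$ (viewed in $\mathbb{R}^n$ via the standard inclusion $\mathbb{R}^k\subset\mathbb{R}^n$) is contained in a single $G$-orbit. *)

(* Defs.v *)
From HB Require Import structures.
From mathcomp Require Import all_boot all_order all_algebra.
From mathcomp Require Import finmap.
From mathcomp Require Import reals.
Set Implicit Arguments. Unset Strict Implicit. Unset Printing Implicit Defensive.
Import Order.TTheory GRing.Theory Num.Theory.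
Local Open Scope ring_scope.
Local Open Scope fset_scope.

Definition edist {R : realType} {m : nat} (u v : 'rV[R]_m) : R :=
  Num.sqrt (\sum_(i < m) (u 0 i - v 0 i) ^+ 2).

Definition affinely_independent {R : realType} {n : nat}
  (A : {fset 'rV[R]_n}) : Prop :=
  forall c : 'rV[R]_n -> R,
    \sum_(a <- A) c a = 0 ->
    \sum_(a <- A) c a *: a = 0 ->
    forall a, a \in A -> c a = 0.

Definition std_incl {R : realType} {k d : nat} (x : 'rV[R]_k) : 'rV[R]_(k + d) :=
  row_mx x 0.

(* An action of the p-torus (Z_p)^alpha, realised as the additive group
   'rV['Z_p]_alpha, on R^m by isometries. *)
Definition isometric_action {R : realType} (p alpha m : nat)
  (act : 'rV['Z_p]_alpha -> 'rV[R]_m -> 'rV[R]_m) : Prop :=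
  [/\ forall x, act 0%R x = x,
      forall g h x, act (g + h)%R x = act g (act h x) &
      forall g x y, edist (act g x) (act g y) = edist x y].

Definition euclidean_sub_p_toral {R : realType} (p : nat) {k : nat}
  (X : {fset 'rV[R]_k}) : Prop :=
  exists (d alpha : nat), (0 < alpha)%N /\
    exists act : 'rV['Z_p]_alpha -> 'rV[R]_(k + d) -> 'rV[R]_(k + d),
      isometric_action act /\
      exists x0 : 'rV[R]_(k + d),
        forall x, x \in X -> exists g, act g x0 = std_incl x.

(* Main.v *)
Require Import Defs.
From HB Require Import structures.
From mathcomp Require Import all_boot all_order all_algebra.
From mathcomp Require Import finmap.
From mathcomp Require Import ring lra.
From mathcomp Require Import reals topology normedtype derive trigo.
Set Implicit Arguments. Unset Strict Implicit. Unset Printing Implicit Defensive.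
Import Order.TTheory GRing.Theory Num.Theory.
Import numFieldNormedType.Exports.
Local Open Scope ring_scope.

(* A torus (Z_p)^a rotating a complex planes realises exactly the squared
   distances in the convex cone spanned by the functions
   |w^(t x) - w^(t y)|^2, where w = exp(2 i pi / p) and t labels the points by
   Z_p; an isometry of the ambient space then moves the orbit onto A. For fixed
   integer labels and large p these functions, rescaled, converge to
   (t x - t y)^2, so every sum of squares (f x - f y)^2 is approximated by the
   cone. Labels with values 0 and 1 give the cut functions exactly, and
   nonnegative combinations of cuts contain a neighbourhood of the function [x != y].
   Affine independence says that the squared distance on A stays a sum of
   squares after subtracting a small multiple of [x != y]; that multiple absorbs
   the approximation error. *)

(** * Euclidean reflections and extension of isometries *)

Section Reflections.
Variables (R : realType) (m : nat).
Implicit Types u v w z a b : 'rV[R]_m.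

Definition dot u v : R := \sum_(i < m) u 0 i * v 0 i.
Definition sqdist u v : R := \sum_(i < m) (u 0 i - v 0 i) ^+ 2.

Lemma dotC u v : dot u v = dot v u.
Proof. by apply: eq_bigr => i _; rewrite mulrC. Qed.

Lemma dotBl u v w : dot (u - v) w = dot u w - dot v w.
Proof.
by rewrite /dot -sumrB; apply: eq_bigr => i _; rewrite !mxE mulrBl.
Qed.

Lemma dotZl c u v : dot (c *: u) v = c * dot u v.
Proof. by rewrite /dot mulr_sumr; apply: eq_bigr => i _; rewrite mxE mulrA. Qed.

Lemma dotBr u v w : dot u (v - w) = dot u v - dot u w.
Proof. by rewrite dotC dotBl !(dotC u). Qed.

Lemma dotZr c u v : dot u (c *: v) = c * dot u v.
Proof. by rewrite dotC dotZl dotC. Qed.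

Lemma dot_eq0 u : (dot u u == 0) = (u == 0).
Proof.
apply/eqP/eqP => [/eqP|->]; last by apply: big1 => i _; rewrite mxE mul0r.
rewrite psumr_eq0 => [|i _]; last by rewrite -expr2 sqr_ge0.
move=> /allP u0; apply/rowP => i; rewrite mxE; apply/eqP.
by have := u0 i (mem_index_enum i); rewrite /= mulf_eq0 orbb.
Qed.

Lemma sqdist_ge0 u v : 0 <= sqdist u v.
Proof. by apply: sumr_ge0 => i _; apply: sqr_ge0. Qed.

Lemma sqdistE u v : sqdist u v = dot (u - v) (u - v).
Proof. by apply: eq_bigr => i _; rewrite !mxE expr2. Qed.

Lemma edist_eq u v u' v' :
  (Defs.edist u v = Defs.edist u' v') <-> (sqdist u v = sqdist u' v').
Proof.
rewrite /Defs.edist -/(sqdist u v) -/(sqdist u' v'); split=> [/eqP|-> //].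
by rewrite eqr_sqrt ?sqdist_ge0 // => /eqP.
Qed.

(* When [a = b] the division by zero makes this the identity. *)
Definition bisector_reflection a b z : 'rV[R]_m :=
  z - ((2 * dot z (b - a) - (dot b b - dot a a)) / dot (b - a) (b - a))
      *: (b - a).

Lemma bisector_reflection_swap a b : bisector_reflection a b b = a.
Proof.
rewrite /bisector_reflection; have [/eqP|nz] := eqVneq (b - a) 0.
  by rewrite subr_eq0 => /eqP ->; rewrite subrr scaler0 subr0.
rewrite (_ : _ / _ = 1) ?scale1r ?subKr // -[RHS](@divff _ (dot (b - a) (b - a))).
  by congr (_ / _); rewrite !(dotBl, dotBr) (dotC a b); ring.
by rewrite dot_eq0.
Qed.

Lemma bisector_reflection_fix a b z :
  sqdist z a = sqdist z b -> bisector_reflection a b z = z.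
Proof.
rewrite !sqdistE !(dotBl, dotBr) (dotC a) (dotC b) => e.
by rewrite /bisector_reflection !dotBr
  (_ : 2 * _ - _ = 0) ?mul0r ?scale0r ?subr0 //; lra.
Qed.

Lemma bisector_reflectionK a b : involutive (bisector_reflection a b).
Proof.
move=> z; rewrite /bisector_reflection; move: (b - a) (dot b b - _) => u c.
have [->|nz] := eqVneq u 0; first by rewrite !scaler0 !subr0.
have nz' : dot u u != 0 by rewrite dot_eq0.
rewrite -addrA -opprD -scalerDl dotBl dotZl (_ : _ / _ + _ / _ = 0) ?scale0r ?subr0 //.
by field.
Qed.

Lemma bisector_reflection_isometry a b z w :
  sqdist (bisector_reflection a b z) (bisector_reflection a b w) = sqdist z w.
Proof.
rewrite /bisector_reflection; move: (b - a) (dot b b - _) => u c.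
have [->|nz] := eqVneq u 0; first by rewrite !scaler0 !subr0.
have nz' : dot u u != 0 by rewrite dot_eq0.
have subE (r t : R) : z - r *: u - (w - t *: u) = (z - w) - (r - t) *: u.
  by rewrite scalerBl !opprB [LHS]addrACA [RHS]addrACA (addrC (- w)).
rewrite !sqdistE subE.
rewrite !(dotBl, dotBr, dotZl, dotZr).
by rewrite (dotC u z) (dotC u w) (dotC w z); field.
Qed.

(* Points are matched one at a time: the reflection sending the next image to
   its target fixes the already matched points, which are equidistant from
   both. *)
Lemma isometry_extension (T : eqType) (s : seq T) (x y : T -> 'rV[R]_m) :
  {in s &, forall i j, sqdist (y i) (y j) = sqdist (x i) (x j)} ->
  exists f g : 'rV[R]_m -> 'rV[R]_m,
    [/\ cancel f g, cancel g f,
        forall u v, sqdist (f u) (f v) = sqdist u v,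
        forall u v, sqdist (g u) (g v) = sqdist u v &
        {in s, forall i, f (y i) = x i}].
Proof.
elim: s => [|a s IHs] xy; first by exists id, id; split.
have [i j ii jj|f [g [fK gK fi gi fx]]] := IHs.
  by apply: xy; rewrite inE ?ii ?jj orbT.
pose r := bisector_reflection (x a) (f (y a)).
exists (r \o f), (g \o r); split=> [u|u|u v|u v|b].
- by rewrite /= /r bisector_reflectionK fK.
- by rewrite /= gK /r bisector_reflectionK.
- by rewrite /= /r bisector_reflection_isometry fi.
- by rewrite /= gi /r bisector_reflection_isometry.
rewrite inE => /predU1P[->|bs] /=; first exact: bisector_reflection_swap.
rewrite (fx b bs); apply: bisector_reflection_fix.
by rewrite -{2}(fx b bs) fi xy // inE ?eqxx ?bs ?orbT.
Qed.

End Reflections.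

(** * Chords between roots of unity *)

Section Chords.
Variables (R : realType) (p : nat).
Hypothesis p_gt1 : (1 < p)%N.
Implicit Types a b c : 'Z_p.

Definition angle (k : nat) : R := pi *+ 2 * k%:R / p%:R.
(** Squared distance between the [p]-th roots of unity labelled [a] and [b]. *)
Definition chord a b : R :=
  (cos (angle a) - cos (angle b)) ^+ 2 + (sin (angle a) - sin (angle b)) ^+ 2.

Let p_neq0 : p%:R != 0 :> R.
Proof. by rewrite pnatr_eq0 -lt0n ltnW. Qed.

(** Makes cosine and sine of an angle depend on its label modulo [p] only, so that addition in
    ['Z_p] composes rotations. *)
Lemma angle_periodic (f : R -> R) k :
  periodic f (pi *+ 2) -> f (angle (k %% p)) = f (angle k).
Proof.
move=> fP; rewrite [in RHS](divn_eq k p) -(periodicn fP (k %/ p)).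
congr f; rewrite /angle natrD natrM -mulr_natr; field.
exact: p_neq0.
Qed.

Lemma angleD k l : angle (k + l) = angle k + angle l.
Proof. by rewrite /angle natrD mulrDr mulrDl. Qed.

Lemma angle0 : angle 0 = 0.
Proof. by rewrite /angle mulr0 mul0r. Qed.

Let val_add a b : (a + b : 'Z_p) = ((a + b) %% p)%N :> nat.
Proof.
rewrite -(val_Zp_nat p_gt1) natrD.
by rewrite !natr_Zp.
Qed.

Lemma cos_angleD a b :
  cos (angle (a + b)%R) =
  cos (angle a) * cos (angle b) - sin (angle a) * sin (angle b).
Proof. by rewrite val_add (angle_periodic _ (@cosD2pi R)) angleD cosD. Qed.

Lemma sin_angleD a b :
  sin (angle (a + b)%R) =
  sin (angle a) * cos (angle b) + cos (angle a) * sin (angle b).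
Proof. by rewrite val_add (angle_periodic _ (@sinD2pi R)) angleD sinD. Qed.

Lemma chordC a b : chord a b = chord b a.
Proof. by rewrite /chord; ring. Qed.

Lemma chordxx a : chord a a = 0.
Proof. by rewrite /chord !subrr expr0n addr0. Qed.

(** Half-angle formula for a chord of the unit circle. By periodicity the right-hand side can use
    the labels before reduction modulo [p]. *)
Lemma chord_nat k l :
  chord k%:R l%:R = 4 * sin ((pi * (k%:R - l%:R)) / p%:R) ^+ 2.
Proof.
rewrite /chord !val_Zp_nat // !(angle_periodic _ (@cosD2pi R)).
rewrite !(angle_periodic _ (@sinD2pi R)).
set t := pi * _ / _; have akE : angle k = angle l + t *+ 2.
  by rewrite /angle /t !mulr2n; field; exact: p_neq0.
have := cos2Dsin2 (angle k); have := cos2Dsin2 (angle l).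
have := cosB (angle k) (angle l).
rewrite {1}akE addrC addKr cos_mulr2n => e1 e2 e3.
rewrite sin2cos2.
have -> : 4 * (1 - cos t ^+ 2) = 2 - 2 * (cos t ^+ 2 *+ 2 - 1) by ring.
rewrite e1; transitivity ((cos (angle k) ^+ 2 + sin (angle k) ^+ 2)
  + (cos (angle l) ^+ 2 + sin (angle l) ^+ 2)
  - 2 * (cos (angle k) * cos (angle l) + sin (angle k) * sin (angle l))).
  by ring.
by rewrite e2 e3.
Qed.

Lemma chord01_gt0 : 0 < chord 0 1.
Proof.
have -> : chord 0 1 = 4 * sin (pi / p%:R) ^+ 2.
  have := chord_nat 0 1; rewrite sub0r mulrN1 mulNr sinN sqrrN; exact.
rewrite mulr_gt0 // exprn_gt0 // sin_gt0_pi //.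
rewrite divr_gt0 ?pi_gt0 ?ltr0n 1?ltnW //= ltr_pdivrMr ?ltr0n 1?ltnW //.
by rewrite ltr_pMr ?pi_gt0 // ltr1n.
Qed.

End Chords.
Arguments angle {R}.
Arguments chord {R p}.

(** * The cone of toric squared distances *)

Section Toric.
Variables (R : realType) (p : nat) (T : eqType) (A : seq T).
Implicit Types D : T -> T -> R.

(** Each entry of [s] stands for one complex plane: the weight is the squared radius of a circle
    there, the label of a point its place among the [p]-th roots of unity. *)
Definition toric D :=
  exists2 s : seq (R * (T -> 'Z_p)), all (fun c => 0 <= c.1) s &
    {in A &, forall x y, D x y = \sum_(c <- s) c.1 * chord (c.2 x) (c.2 y)}.

Lemma eq_toric D D' : {in A &, D =2 D'} -> toric D -> toric D'.
Proof. by move=> DD' [s s0 Ds]; exists s => // x y xA yA; rewrite -DD' ?Ds. Qed.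

Lemma toric0 : toric (fun _ _ => 0).
Proof. by exists [::] => // x y _ _; rewrite big_nil. Qed.

Lemma toricD D D' : toric D -> toric D' -> toric (fun x y => D x y + D' x y).
Proof.
move=> [s s0 Ds] [s' s0' Ds']; exists (s ++ s'); first by rewrite all_cat s0.
by move=> x y xA yA; rewrite big_cat Ds ?Ds'.
Qed.

Lemma toricZ k D : 0 <= k -> toric D -> toric (fun x y => k * D x y).
Proof.
move=> k0 [s s0 Ds]; exists [seq (k * c.1, c.2) | c <- s].
  by rewrite all_map; apply: sub_all s0 => c /= c0; rewrite mulr_ge0.
move=> x y xA yA; rewrite big_map Ds // mulr_sumr.
by apply: eq_bigr => c _ /=; rewrite mulrA.
Qed.

Lemma toric_sum (I : eqType) (r : seq I) (F : I -> T -> T -> R) :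
  {in r, forall i, toric (F i)} -> toric (fun x y => \sum_(i <- r) F i x y).
Proof.
elim: r => [|i r IHr] Fr.
  by apply: eq_toric toric0 => x y _ _; rewrite big_nil.
apply: (@eq_toric (fun x y => F i x y + \sum_(j <- r) F j x y)).
  by move=> x y _ _; rewrite big_cons.
by apply: toricD; [apply: Fr|apply: IHr => j jr; apply: Fr];
  rewrite inE ?eqxx ?jr ?orbT.
Qed.

Lemma toric_sym D : toric D -> {in A &, forall x y, D x y = D y x}.
Proof.
move=> [s _ Ds] x y xA yA; rewrite !Ds //.
by apply: eq_bigr => c _; rewrite chordC.
Qed.

Lemma toric_diag D : toric D -> {in A, forall x, D x x = 0}.
Proof.
by move=> [s _ Ds] x xA; rewrite Ds // big1 // => c _; rewrite chordxx mulr0.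
Qed.

(** Label by 0 and 1 and divide by the only nonzero chord that occurs. *)
Lemma toric_cut (U : pred T) :
  (1 < p)%N -> toric (fun x y => (U x (+) U y)%:R).
Proof.
move=> p1; exists [:: ((chord (0 : 'Z_p) 1)^-1, fun x => (U x)%:R)] => /=.
  by rewrite andbT invr_ge0 ltW // chord01_gt0.
move=> x y _ _; rewrite big_seq1 /=.
have c0 : chord (0 : 'Z_p) 1 != 0 :> R by rewrite gt_eqF // chord01_gt0.
case: (U x); case: (U y); rewrite /= !(mulr0n, mulr1n) ?chordxx ?mulr0 ?mulVf //.
by rewrite [chord 1 _]chordC mulVf.
Qed.

End Toric.

(** * Plane rotations and realisation of the cone *)

Section Realization.
Variables (R : realType) (p : nat).
Hypothesis p_gt1 : (1 < p)%N.
Variables (k a : nat).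

(** The last [a + a] coordinates form [a] planes, the [i]-th spanned by coordinate [i] of each half.
    The first [k] coordinates make room for the given set and stay fixed. *)
Definition rotate (g : 'rV['Z_p]_a) (z : 'rV[R]_(k + (a + a))) :
    'rV[R]_(k + (a + a)) :=
  let u := lsubmx (rsubmx z) in let v := rsubmx (rsubmx z) in
  row_mx (lsubmx z) (row_mx
    (\row_i (cos (angle p (g 0 i)) * u 0 i - sin (angle p (g 0 i)) * v 0 i))
    (\row_i (sin (angle p (g 0 i)) * u 0 i + cos (angle p (g 0 i)) * v 0 i))).

Lemma sqdist_row_mx (m n : nat) (u u' : 'rV[R]_m) (v v' : 'rV[R]_n) :
  sqdist (row_mx u v) (row_mx u' v') = sqdist u u' + sqdist v v'.
Proof.
rewrite /sqdist big_split_ord /=; congr (_ + _); apply: eq_bigr => i _.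
  by rewrite !row_mxEl.
by rewrite !row_mxEr.
Qed.

Lemma rotate_action : isometric_action rotate.
Proof.
split=> [z|g h z|g z w].
- rewrite /rotate -[RHS]hsubmxK -[X in _ = row_mx _ X]hsubmxK.
  congr (row_mx _ (row_mx _ _)); apply/rowP=> i;
    by rewrite !mxE angle0 cos0 sin0 mul1r mul0r ?subr0 ?add0r.
- rewrite /rotate !(row_mxKl, row_mxKr).
  congr (row_mx _ (row_mx _ _)); apply/rowP=> i;
    rewrite !mxE (cos_angleD _ p_gt1) (sin_angleD _ p_gt1); ring.
apply/edist_eq; rewrite -[in RHS](hsubmxK z) -[in RHS](hsubmxK w).
rewrite -[in RHS](hsubmxK (rsubmx z)) -[in RHS](hsubmxK (rsubmx w)).
rewrite /rotate !sqdist_row_mx; congr (_ + _).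
rewrite /sqdist -!big_split; apply: eq_bigr => i _ /=; rewrite !mxE.
have := cos2Dsin2 (angle p (g 0 i) : R) => e.
set x := z _ _; set x' := w _ _; set y := z _ _; set y' := w _ _.
transitivity ((cos (angle p (g 0 i)) ^+ 2 + sin (angle p (g 0 i)) ^+ 2)
  * ((x - x') ^+ 2 + (y - y') ^+ 2)); first by ring.
by rewrite e mul1r.
Qed.

End Realization.

(** The orbit of one point [z] contains a copy of [A] with the same distances. An ambient isometry
    [f] moves this copy onto [A], and conjugating the rotations by [f] gives the required action. *)
Lemma toric_sub_p_toral (R : realType) (p k : nat) (A : {fset 'rV[R]_k}) :
  (1 < p)%N -> toric p A (@sqdist R k) -> euclidean_sub_p_toral p A.
Proof.
move=> p1 [s s0 Ds].
(* The added entry of weight 0 changes no distance and ensures [0 < a], even when [s] is empty. *)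
pose s' := (0, fun=> 0) :: s; pose a := size s'.
pose wt (i : 'I_a) : R := (nth (0, fun=> 0) s' i).1.
pose lb (i : 'I_a) : 'rV[R]_k -> 'Z_p := (nth (0, fun=> 0) s' i).2.
have wt0 i : 0 <= wt i.
  have s'0 : all (fun c => 0 <= c.1) s' by rewrite /= lexx.
  exact: (all_nthP (0, fun=> 0) s'0 i (ltn_ord i)).
exists (a + a)%N, a; split=> //.
(* In plane [i] the orbit of [z] lies on the circle of squared radius [wt i]. *)
pose z : 'rV[R]_(k + (a + a)) := row_mx 0 (row_mx (\row_i Num.sqrt (wt i)) 0).
pose g x : 'rV['Z_p]_a := \row_i lb i x.
pose y x := rotate (g x) z.
have [u v uA vA|f [f' [fK f'K fi fi' fy]]] :=
    @isometry_extension R _ _ A (@std_incl R k (a + a)) y.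
  rewrite /std_incl sqdist_row_mx [X in _ + X]big1 ?addr0; last first.
    by move=> i _; rewrite !mxE subrr expr0n.
  rewrite Ds // /y /rotate /z !(row_mxKl, row_mxKr) !sqdist_row_mx.
  rewrite [X in X + _]big1 ?add0r; last by move=> i _; rewrite !mxE subrr expr0n.
  rewrite /sqdist -big_split /=.
  transitivity (\sum_(c <- s') c.1 * chord (c.2 u) (c.2 v)); last first.
    by rewrite big_cons mul0r add0r.
  rewrite (big_nth (0, fun=> 0)) big_mkord; apply: eq_bigr => i _.
  rewrite !mxE !mulr0 subr0 addr0 /chord -/(wt i) -/(lb i u) -/(lb i v).
  rewrite -[in RHS](sqr_sqrtr (wt0 i)); ring.
have [r1 rD ri] := rotate_action R p1 k a.
exists (fun h => f \o rotate h \o f'); split.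
  split=> [x|h h' x|h x x'] /=; first by rewrite r1 f'K.
    by rewrite rD fK.
  by apply/edist_eq; rewrite fi -(fi' x); apply/edist_eq; apply: ri.
by exists (f z) => x xA; exists (g x); rewrite /= fK -fy.
Qed.

(** * Bounds on the squared sine *)

Section SineBound.
Variable R : realType.
Implicit Types x c : R.

Lemma sin_mvt x : exists2 c, `|c| <= `|x| & sin x = cos c * x.
Proof.
have pos (y : R) : 0 <= y -> exists2 c : R, `|c| <= `|y| & sin y = cos c * y.
  move=> y0; have [|c cy sE] := @MVT_segment R sin cos 0 y y0 (fun z _ => is_derive_sin z).
    exact/continuous_subspaceT/continuous_sin.
  exists c; last by rewrite sin0 !subr0 in sE.
  by move: cy; rewrite in_itv /= => /andP[c0 cy]; rewrite !ger0_norm.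
have [/pos//|/ltW x0] := leP 0 x.
have [|c cx sE] := pos (- x); first by rewrite oppr_ge0.
by exists c; [rewrite -(normrN x)|apply: oppr_inj; rewrite -sinN sE mulrN].
Qed.

Lemma sin2_le x : sin x ^+ 2 <= x ^+ 2.
Proof.
have [c _ ->] := sin_mvt x; rewrite exprMn ler_piMl ?sqr_ge0 //.
by rewrite cos2sin2 gerBl sqr_ge0.
Qed.

(** Here [sin x ^+ 2 = (1 - sin c ^+ 2) * x ^+ 2] with [c] no larger than [x] in absolute value, and
    the upper bound applies to [sin c]. *)
Lemma sin2_ge x : x ^+ 2 - x ^+ 4 <= sin x ^+ 2.
Proof.
have [c cx ->] := sin_mvt x.
have sx : sin c ^+ 2 <= x ^+ 2.
  by apply: le_trans (sin2_le c) _; rewrite -(real_normK (num_real c))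
    -(real_normK (num_real x)) lerXn2r ?nnegrE.
rewrite exprMn cos2sin2 mulrBl mul1r lerB //.
by rewrite -[4%N]/(2 + 2)%N exprD ler_wpM2r ?sqr_ge0.
Qed.

End SineBound.

(** * Sums of squares as limits of toric functions *)

Section Approximation.
Variables (R : realType) (T : eqType) (A : seq T).
Implicit Types (D : T -> T -> R) (f : T -> R) (e : R).

(** The approximant may vary with [p], which permits weights that grow with [p]. *)
Definition asymptotically_toric D := forall e, 0 < e ->
  exists p0 : nat, forall p, prime p -> (p0 <= p)%N ->
    exists2 D', toric p A D' & {in A &, forall x y, `|D x y - D' x y| <= e}.

Local Notation atoric := asymptotically_toric.

Lemma atoric_limit D :
  (forall e, 0 < e ->
    exists2 D', atoric D' & {in A &, forall x y, `|D x y - D' x y| <= e}) ->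
  atoric D.
Proof.
move=> DD e e0; have e20 : 0 < e / 2 by rewrite divr_gt0.
have [D' /(_ _ e20)[p0 D'p] D'e] := DD _ e20.
exists p0 => p pp pp0; have [E tE Ee] := D'p _ pp pp0; exists E => // x y xA yA.
rewrite -(subrK (D' x y) (D x y)) -addrA (le_trans (ler_normD _ _)) //.
by rewrite [leRHS]splitr lerD ?D'e ?Ee.
Qed.

Lemma eq_atoric D D' : {in A &, D =2 D'} -> atoric D -> atoric D'.
Proof.
move=> DD' tD; apply: atoric_limit => e e0; exists D => // x y xA yA.
by rewrite DD' // subrr normr0 ltW.
Qed.

Lemma atoric0 : atoric (fun _ _ => 0).
Proof.
move=> e e0; exists 0%N => p _ _; exists (fun _ _ => 0); first exact: toric0.
by move=> x y _ _; rewrite subrr normr0 ltW.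
Qed.

Lemma atoricD D D' : atoric D -> atoric D' -> atoric (fun x y => D x y + D' x y).
Proof.
move=> tD tD' e e0; have e20 : 0 < e / 2 by rewrite divr_gt0.
have [p0 Dp] := tD _ e20; have [p1 D'p] := tD' _ e20.
exists (maxn p0 p1) => p pp; rewrite geq_max => /andP[/(Dp _ pp)[E tE Ee]].
move=> /(D'p _ pp)[E' tE' Ee']; exists (fun x y => E x y + E' x y).
  exact: toricD.
move=> x y xA yA; rewrite opprD addrACA (le_trans (ler_normD _ _)) //.
by rewrite [leRHS]splitr lerD ?Ee ?Ee'.
Qed.

Lemma atoricZ k D : 0 <= k -> atoric D -> atoric (fun x y => k * D x y).
Proof.
move=> k0 tD e e0; have k10 : 0 < k + 1 by rewrite ltr_wpDl.
have [p0 Dp] := tD (e / (k + 1)) (divr_gt0 e0 k10).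
exists p0 => p pp /(Dp _ pp)[E tE Ee]; exists (fun x y => k * E x y).
  exact: toricZ.
move=> x y xA yA; rewrite -mulrBr normrM ger0_norm //.
apply: le_trans (ler_wpM2l k0 (Ee _ _ xA yA)) _.
by rewrite mulrCA ger_pMr // ler_pdivrMr // mul1r lerDl.
Qed.

Lemma atoric_sum (I : Type) (r : seq I) (F : I -> T -> T -> R) :
  (forall i, atoric (F i)) -> atoric (fun x y => \sum_(i <- r) F i x y).
Proof.
move=> tF; elim: r => [|i r IHr].
  by apply: eq_atoric atoric0 => x y _ _; rewrite big_nil.
apply: (@eq_atoric (fun x y => F i x y + \sum_(j <- r) F j x y)).
  by move=> x y _ _; rewrite big_cons.
exact: atoricD.
Qed.

(* The labels [t] are kept fixed while [p] grows: the rescaled chord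
   [(p / pi)^2 sin^2 (pi k / p)] tends to [k ^ 2]. *)
Lemma atoric_nat (t : T -> nat) :
  atoric (fun x y => ((t x)%:R - (t y)%:R) ^+ 2).
Proof.
move=> e e0; pose K : R := (\sum_(x <- A) t x)%:R.
have K0 : 0 <= K by rewrite ler0n.
(* As [K] bounds the label differences and [pi <= 4], the error is at most [16 * K ^+ 4 / p ^+ 2],
   hence at most [e]. *)
exists (Num.bound (16 * K ^+ 4 / e)) => p pp pK.
have p1 := prime_gt1 pp.
have p0 : 0 < p%:R :> R by rewrite ltr0n ltnW.
have {}pK : 16 * K ^+ 4 / e < p%:R.
  apply: lt_le_trans (archi_boundP _) _; last by rewrite ler_nat.
  by rewrite divr_ge0 ?mulr_ge0 ?exprn_ge0 // ltW.
have pi0 := pi_gt0 R.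
exists (fun x y => (p%:R / (2 * pi)) ^+ 2 * chord (t x)%:R ((t y)%:R : 'Z_p)).
  apply: toricZ; first exact: sqr_ge0.
  exists [:: (1, fun x => (t x)%:R)]; first by rewrite /= ler01.
  by move=> x y _ _; rewrite big_seq1 mul1r.
move=> x y xA yA; rewrite chord_nat //; set k : R := (t x)%:R - (t y)%:R.
have kK : `|k| <= K.
  have tK z : z \in A -> (t z)%:R <= K.
    by move=> zA; rewrite ler_nat (big_rem z zA) leq_addr.
  have := tK _ xA; have := tK _ yA; have := ler0n R (t x); have := ler0n R (t y).
  by rewrite ler_norml /k; lra.
set u := pi * k / p%:R.
have pn0 : p%:R != 0 :> R by rewrite gt_eqF.
have pin0 : pi != 0 :> R by rewrite gt_eqF.
have kE : k ^+ 2 = 4 * (p%:R / (2 * pi)) ^+ 2 * u ^+ 2.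
  by rewrite /u; move: pi pin0 => q q0; field; apply/andP.
set w := (p%:R / (2 * pi)) ^+ 2 in kE *; have w0 : 0 <= w by rewrite sqr_ge0.
rewrite kE (_ : _ - _ = 4 * w * (u ^+ 2 - sin u ^+ 2)); last by ring.
have w40 : 0 <= 4 * w by apply: mulr_ge0.
rewrite ger0_norm; last by apply: mulr_ge0; rewrite ?subr_ge0 ?sin2_le.
have su : u ^+ 2 - sin u ^+ 2 <= u ^+ 4 by have := sin2_ge u; lra.
apply: le_trans (ler_wpM2l w40 su) _.
have -> : 4 * w * u ^+ 4 = pi ^+ 2 * k ^+ 4 / p%:R ^+ 2.
  by rewrite /w /u; move: pi pin0 => q q0; field; apply/andP.
have k4 : k ^+ 4 <= K ^+ 4.
  by rewrite -[k ^+ 4](@ger0_norm R) ?exprn_even_ge0 // normrX lerXn2r ?nnegrE.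
have pi4 : pi ^+ 2 <= 16 :> R.
  by have := pihalf_lt2 R; nra.
rewrite ler_pdivrMr ?exprn_gt0 //.
apply: (@le_trans _ _ (16 * K ^+ 4)).
  by apply: ler_pM => //; rewrite ?sqr_ge0 ?exprn_even_ge0.
move: pK; rewrite ltr_pdivrMr // => /ltW/le_trans; apply.
rewrite [leRHS]mulrC; apply: ler_wpM2r; first exact: ltW.
by apply: ler_eXnr => //; rewrite -[leLHS]/(1%:R) ler_nat ltnW.
Qed.

(** Round [N * (f x + B)] down to natural labels. The shift by [B] makes the values nonnegative on
    [A] and cancels in differences. *)
Lemma atoric_real f : atoric (fun x y => (f x - f y) ^+ 2).
Proof.
apply: atoric_limit => e e0.
pose B : R := \sum_(x <- A) `|f x|; have B0 : 0 <= B by apply: sumr_ge0.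
(* Rounding perturbs a difference of values by at most [1 / N], hence its square by at most
   [(4 * B + 1) / N]; the successor ensures [1 <= N]. *)
pose N : R := (Num.bound ((4 * B + 1) / e)).+1%:R.
have N1 : 1 <= N by rewrite /N -[leLHS]/(1%:R) ler_nat.
have N0 : 0 < N by apply: lt_le_trans N1.
have NB : (4 * B + 1) / e < N.
  apply: lt_le_trans (archi_boundP _) _; last by rewrite ler_nat.
  by rewrite divr_ge0 ?(ltW e0) //; lra.
pose t x := Num.trunc (N * (f x + B)).
exists (fun x y => N ^- 2 * ((t x)%:R - (t y)%:R) ^+ 2).
  by apply: atoricZ; [rewrite invr_ge0 sqr_ge0|exact: atoric_nat].
have fB z : z \in A -> `|f z| <= B.
  by move=> zA; rewrite /B (big_rem z zA) /= lerDl sumr_ge0.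
have ft z : z \in A -> exists2 r : R, 0 <= r <= 1 & (t z)%:R = N * (f z + B - r / N).
  move=> zA; exists (N * (f z + B) - (t z)%:R).
    have /truncn_itv : 0 <= N * (f z + B).
      by have := fB z zA; rewrite ler_norml => /andP[h _]; apply: mulr_ge0; lra.
    by rewrite -/(t z) -natr1; lra.
  by field; rewrite gt_eqF.
move=> x y xA yA; have [r r01 ->] := ft x xA; have [s s01 ->] := ft y yA.
have fx : - B <= f x <= B by rewrite -ler_norml fB.
have fy : - B <= f y <= B by rewrite -ler_norml fB.
set d := f x - f y; set h : R := (r - s) / N.
have -> : N ^- 2 * (N * (f x + B - r / N) - N * (f y + B - s / N)) ^+ 2 = (d - h) ^+ 2.
  by rewrite /d /h; field; rewrite gt_eqF.
have hN : `|h| <= 1 / N.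
  by rewrite normrM normfV (gtr0_norm N0) ler_pM2r ?invr_gt0 // ler_norml; lra.
have h1 : `|h| <= 1 by apply: le_trans hN _; rewrite div1r invf_le1.
have -> : d ^+ 2 - (d - h) ^+ 2 = h * (2 * d - h) by ring.
have dh : `|2 * d - h| <= 4 * B + 1.
  by move: h1; rewrite !ler_norml /d; lra.
rewrite normrM (le_trans (ler_pM _ _ hN dh)) //.
by rewrite mulrAC mul1r ler_pdivrMr // -ler_pdivrMl // mulrC ltW.
Qed.

End Approximation.

(** * Absorbing the error with cuts *)

Section Reserve.
Variables (R : realType) (T : eqType) (A : seq T).
Hypothesis uA : uniq A.
Implicit Types D : T -> T -> R.

Definition cut (i x y : T) : R := ((x == i) (+) (y == i))%:R.

(** Among the cuts of single points, only those of [x] and [y] separate [x] from [y]. *)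
Lemma sum_cut (G : T -> R) x y : x \in A -> y \in A -> x != y ->
  \sum_(i <- A) G i * cut i x y = G x + G y.
Proof.
move=> xA yA xy.
have pick z : z \in A -> \sum_(i <- A) G i * (z == i)%:R = G z.
  move=> zA; rewrite (bigD1_seq z) //= eqxx mulr1 big1 ?addr0 // => i iz.
  by rewrite eq_sym (negbTE iz) mulr0.
rewrite -(pick x xA) -(pick y yA) -big_split; apply: eq_bigr => i _ /=.
rewrite -mulrDr /cut; congr (_ * _).
have [xi|_] := eqVneq x i; have [yi|_] := eqVneq y i; rewrite ?addr0 ?add0r //.
by rewrite xi yi eqxx in xy.
Qed.

(* The cut of the pair [{i, j}] equals [cut i + cut j - 2 * cut i * cut j].
   Hence a small negative multiple of the indicator of [{x, y} = {i, j}] is a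
   nonnegative multiple of a cut, up to multiples of [cut i] and [cut j] that
   are absorbed by [x != y], which is half the sum of all the [cut i]. *)
Lemma toric_of_reserve D (d : R) : 0 < d ->
  {in A &, forall x y, D x y = D y x} -> {in A, forall x, D x x = 0} ->
  asymptotically_toric A (fun x y => D x y - d * (x != y)%:R) ->
  exists p0 : nat, forall p, prime p -> (p0 <= p)%N -> toric p A D.
Proof.
move=> d0 Dsym D0 tD; pose m : R := (size A)%:R.
have m0 : 0 <= m by rewrite ler0n.
(* Each [F i j] below is at most [2 * e], so this choice bounds the row sums [g] by [d]. *)
pose e : R := d / (2 * (m + 1)); have e0 : 0 < e by rewrite divr_gt0 //; lra.
have [p0 Dp] := tD e e0; exists p0 => p pp /(Dp _ pp)[D' tD' D'e].
(* Off the diagonal [D - D' = d + E = d + e - F], with [F] the error shifted to be nonnegative. *)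
pose E x y := D x y - d * (x != y)%:R - D' x y.
pose F i j : R := (i != j)%:R * (e - E i j).
pose g i := \sum_(j <- A) F i j.
have F_ge0 : {in A &, forall i j, 0 <= F i j}.
  move=> i j iA jA; rewrite mulr_ge0 // subr_ge0.
  exact: le_trans (ler_norm _) (D'e _ _ iA jA).
have F_le : {in A &, forall i j, F i j <= 2 * e}.
  move=> i j iA jA; have := D'e _ _ iA jA; rewrite -/(E i j) ler_norml.
  by rewrite /F; move: (E i j) => z; case: (i != j); rewrite ?mul1r ?mul0r; lra.
have Fxx i : F i i = 0 by rewrite /F eqxx mul0r.
have Fsym : {in A &, forall i j, F i j = F j i}.
  move=> i j iA jA; rewrite /F /E eq_sym Dsym //.
  by rewrite (toric_sym tD' iA jA) // (eq_sym i).
have g_le i : i \in A -> g i <= d.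
  move=> iA; apply: (@le_trans _ _ (\sum_(j <- A) 2 * e)).
    by rewrite /g big_seq [leRHS]big_seq; apply: ler_sum => j jA; apply: F_le.
  rewrite big_const_seq count_predT iter_addr_0 -[_ *+ size A]mulr_natr -/m.
  rewrite (_ : _ * m = d * (m / (m + 1))); last by rewrite /e; field; lra.
  by rewrite ger_pMr // ler_pdivrMr; lra.
have gE x : x \in A -> \sum_(i <- A) F i x = g x.
  by move=> xA; apply: eq_big_seq => i iA; apply: Fsym.
(* With weights [F i j / 4] over ordered pairs, the pair cuts add up to [(g x + g y) / 2 - F x y];
   adding [c x + c y] leaves [d + e - F x y]. *)
pose c i := (d + e - g i) / 2.
pose cut2 (i j x y : T) : R := (((x == i) (+) (x == j)) (+) ((y == i) (+) (y == j)))%:R.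
have cut2E i j x y :
    cut2 i j x y = cut i x y * (1 - 2 * cut j x y) + cut j x y.
  by rewrite /cut2 /cut; case: (x == i); case: (x == j); case: (y == i);
    case: (y == j); rewrite /=; ring.
apply: (@eq_toric _ _ _ _ (fun x y => D' x y + (\sum_(i <- A) c i * cut i x y +
    \sum_(i <- A) \sum_(j <- A) F i j / 4 * cut2 i j x y))); last first.
  apply: toricD => //; apply: toricD.
    apply: toric_sum => i iA; apply: toricZ.
      by rewrite /c; have := g_le i iA; lra.
    exact: (toric_cut _ _ (pred1 i) (prime_gt1 pp)).
  apply: toric_sum => i iA; apply: toric_sum => j jA; apply: toricZ.
    by rewrite divr_ge0 ?F_ge0.
  exact: (toric_cut _ _ (fun x => (x == i) (+) (x == j)) (prime_gt1 pp)).
move=> x y xA yA; have [<-|xy] := eqVneq x y.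
  rewrite (toric_diag tD') // D0 // big1 ?big1 ?addr0 // => i _.
    by rewrite big1 // => j _; rewrite /cut2 addbb mulr0.
  by rewrite /cut addbb mulr0.
have -> : D x y = D' x y + (d + e - F x y).
  by rewrite /F /E xy /= mulr1n; ring.
congr (_ + _); rewrite sum_cut //.
under eq_bigr => i _.
  rewrite (_ : \sum_(j <- A) _ = (g i / 4 - (F i x + F i y) / 2) * cut i x y
      + (F i x + F i y) / 4); last first.
    transitivity (\sum_(j <- A) (F i j * (cut i x y / 4) +
        F i j * (1 / 4 - cut i x y / 2) * cut j x y)).
      by apply: eq_bigr => j _; rewrite cut2E; field.
    by rewrite big_split /= -mulr_suml -/(g i) sum_cut //; field.
  over.
rewrite big_split /= sum_cut // !Fxx -mulr_suml big_split /= !gE //.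
by rewrite (Fsym y x) // /c; field.
Qed.

End Reserve.

(** * Affine independence and the reserve *)

(** Writes the Cauchy-Schwarz defect as a sum of squares of forms linear in [v], which is what the
    approximation accepts. *)
Lemma lagrange_identity (R : realType) (n : nat) (u v : 'rV[R]_n) :
  dot u u * dot v v - dot u v ^+ 2 =
  \sum_b \sum_c 2^-1 * (u 0 b * v 0 c - u 0 c * v 0 b) ^+ 2.
Proof.
have e : dot u u * dot v v - dot u v ^+ 2 =
    2^-1 * (dot u u * dot v v + dot v v * dot u u - 2 * (dot u v * dot u v)).
  by field.
rewrite e /dot !big_distrlr /= mulr_sumr -big_split /= -sumrB mulr_sumr.
apply: eq_bigr => b _; rewrite mulr_sumr -big_split /= -sumrB mulr_sumr.
by apply: eq_bigr => c _; ring.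
Qed.

(* The separating functionals are the columns of a right inverse of the matrix
   with rows [(a, 1)], [a \in A], whose rows are linearly independent. *)
Lemma affinely_independent_functionals (R : realType) (n : nat)
    (A : {fset 'rV[R]_n}) :
  affinely_independent A -> exists (m : nat) (l : 'I_m -> 'rV[R]_n),
    {in A &, forall x y, \sum_i dot (l i) (x - y) ^+ 2 = 2 * (x != y)%:R}.
Proof.
move=> indA; pose m := size (enum_fset A).
pose a (i : 'I_m) : 'rV[R]_n := nth 0 (enum_fset A) i.
have aE x : x \in A -> exists i, x = a i.
  move=> xA; have im : (index x (enum_fset A) < m)%N by rewrite index_mem.
  by exists (Ordinal im); rewrite /a nth_index.
have a_inj : injective a.
  by move=> i j /eqP; rewrite nth_uniq ?fset_uniq // => /eqP/val_inj.
pose M : 'M[R]_(m, n + 1) := \matrix_i row_mx (a i) 1%:M.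
have freeM : row_free M.
  (* A vanishing combination of the rows is an affine dependence: the column of ones says that the
     coefficients sum to 0, the other columns that the combination of points is 0. *)
  apply: inj_row_free => v vM.
  pose c x := \sum_(i < m | a i == x) v 0 i.
  have ca i : c (a i) = v 0 i.
    by rewrite /c (big_pred1 i) // => j; rewrite /= (inj_eq a_inj).
  have vMk k : \sum_i v 0 i * M i k = 0 by have /rowP/(_ k) := vM; rewrite !mxE.
  apply/rowP => i; rewrite mxE -ca; apply: indA; last by rewrite mem_nth.
    rewrite (big_nth 0) big_mkord -[RHS](vMk (rshift n 0)).
    by apply: eq_bigr => j _; rewrite -/(a j) ca [M j _]mxE row_mxEr mxE mulr1.
  rewrite (big_nth 0) big_mkord; apply/rowP => k.
  rewrite summxE [RHS]mxE -[RHS](vMk (lshift 1 k)).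
  by apply: eq_bigr => j _; rewrite -/(a j) ca [M j _]mxE row_mxEl mxE.
have [N MN] : exists N, M *m N = 1%:M by exists (pinvmx M); apply: mulmxVp.
(* Column [i] of [N] is an affine function equal to 1 at [a i] and to 0 at the other points. Its
   last entry is the constant term, which cancels in differences. *)
exists m, (fun i => \row_k N (lshift 1 k) i).
have dotE i j : dot (\row_k N (lshift 1 k) i) (a j) + N (rshift n 0) i = (j == i)%:R.
  have /matrixP/(_ j i) := MN; rewrite [LHS]mxE [RHS]mxE => <-.
  rewrite big_split_ord big_ord1 /=; congr (_ + _).
    by apply: eq_bigr => k _; rewrite [M j _]mxE row_mxEl mxE mulrC.
  by rewrite [M j _]mxE row_mxEr mxE eqxx mul1r.
move=> _ _ /aE[j ->] /aE[k ->]; rewrite (inj_eq a_inj).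
transitivity (\sum_i ((j == i)%:R - (k == i)%:R : R) ^+ 2).
  by apply: eq_bigr => i _; rewrite -!dotE dotBr; ring.
have [<-|jk] := eqVneq j k.
  by rewrite mulr0 big1 // => i _; rewrite subrr expr0n.
have kj : (k == j) = false by rewrite eq_sym (negbTE jk).
rewrite (bigD1 j) //= (bigD1 k) ?kj //= !eqxx (negbTE jk).
rewrite big1 => [|i /andP[ij ik]]; first by rewrite /= !(mulr0n, mulr1n); ring.
by rewrite !(eq_sym _ i) (negbTE ij) (negbTE ik) subrr expr0n.
Qed.

Local Open Scope fset_scope.

Theorem theorem6 (R : realType) (n : nat) (A : {fset 'rV[R]_n}) :
  affinely_independent A ->
  exists p0 : nat, forall p : nat, prime p -> (p0 <= p)%N ->
    euclidean_sub_p_toral p A.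
Proof.
move=> /affinely_independent_functionals[m [l lA]].
(* Chosen so that [d * (1 + \sum_i dot (l i) (l i)) = 1]. On [A], subtracting
   [d * \sum_i dot (l i) (x - y) ^+ 2] means subtracting the reserve [2 * d * (x != y)]. *)
pose d : R := (1 + \sum_i dot (l i) (l i))^-1.
have l0 : 0 <= \sum_i dot (l i) (l i).
  by apply: sumr_ge0 => i _; apply: sumr_ge0 => k _; rewrite -expr2 sqr_ge0.
have d0 : 0 < d by rewrite invr_gt0; lra.
suff [p0 Ap] : exists p0 : nat, forall p, prime p -> (p0 <= p)%N ->
    toric p A (@sqdist R n).
  exists p0 => p pp pp0; apply: toric_sub_p_toral (Ap p pp pp0).
  exact: prime_gt1.
apply: (@toric_of_reserve _ _ _ (fset_uniq A) _ (2 * d)).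
- by rewrite mulr_gt0.
- by move=> x y _ _; apply: eq_bigr => i _; ring.
- by move=> x _; apply: big1 => i _; rewrite subrr expr0n.
(* By the Lagrange identity, the squared distance minus the reserve is a nonnegative combination of
   squared differences of coordinates and of these forms. *)
pose f i b c (x : 'rV[R]_n) := l i 0 b * x 0 c - l i 0 c * x 0 b.
apply: (@eq_atoric R 'rV[R]_n (enum_fset A) (fun x y : 'rV[R]_n =>
  d * (\sum_b (x 0 b - y 0 b) ^+ 2 +
  \sum_i \sum_b \sum_c 2^-1 * (f i b c x - f i b c y) ^+ 2))).
  move=> x y xA yA.
  transitivity (d * (sqdist x y +
    \sum_i (dot (l i) (l i) * sqdist x y - dot (l i) (x - y) ^+ 2))).
    congr (_ * (_ + _)); apply: eq_bigr => i _.
    rewrite sqdistE lagrange_identity; apply: eq_bigr => b _.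
    by apply: eq_bigr => c _; rewrite /f !mxE; congr (_ * _ ^+ 2); ring.
  rewrite sumrB lA // -mulr_suml.
  rewrite (_ : d * _ = (d * (1 + \sum_i dot (l i) (l i))) * sqdist x y
    - 2 * d * (x != y)%:R); last by ring.
  by rewrite mulVf ?mul1r //; lra.
apply: atoricZ (ltW d0) _; apply: atoricD.
  by apply: atoric_sum => b; exact: (@atoric_real R 'rV[R]_n _ (fun x => x 0 b)).
apply: atoric_sum => i; apply: atoric_sum => b; apply: atoric_sum => c.
by apply: atoricZ (atoric_real _ _); rewrite invr_ge0.
Qed.
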